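(* Let $X_t$ be a Markov process on $S$ with transition semigroup $(P_t)_{t\ge0}$, let $\phi:S\to\hat S$ be a map with associated kernel $\Phi$, and let $\Lambda$ be a Markov kernel from $\hat S$ to $S$. Assume that $\Lambda\Phi$ is the identity on $\hat S$, and that $\pi_{\hat S}$ is a measure on $\hat S$ with $\pi_{\hat S}\Lambda P_t=\pi_{\hat S}\Lambda P_t\Phi\Lambda$ for all $t\ge0$. Set $\pi_S:=\pi_{\hat S}\Lambda$ and $Q_t:=\Lambda P_t\Phi$. Suppose that $X_t$ is reversible, i.e. there exists a diagonal $S\times S$ matrix $V$ such that $V^{-1}P_tV=P_t^*$. Additionally, suppose that there exists a constant $\mathfrak c$ such that $\Lambda=\mathfrak c\,\Phi^*$. If $D$ is an $S\times S$ matrix with $P_tD=DP_t^*$ for all $t\ge 0$ and $\pi_SD\Phi\Lambda=\pi_SD$, then, setting $\tilde D=\Lambda D\Phi$, we have $$\pi_{\hat S}Q_t\tilde D=\pi_{\hat S}\tilde DQ_t^*\quad\text{for all }t\ge0.$$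
   Context: $S$ and $\hat S$ are countable discrete sets. Operators are composed from left to right: a kernel from $A$ to $B$ is a matrix with rows indexed by $A$ and columns indexed by $B$, and measures are row vectors multiplying matrices on the left. For $\phi:S\to\hat S$, the kernel $\Phi$ from $S$ to $\hat S$ is defined by $\Phi f=f\circ\phi$, i.e. $\Phi(x,y)=1_{\{\phi(x)=y\}}$. The superscript $^*$ denotes transposition.
   Formalization: Since the products involve infinite signed matrices, it is additionally assumed that both sides of the conclusion, expanded as multiple series in the entries of D (assumed real), are well defined: at each entry, the positive and negative parts are not both infinite. *)

(* Defs.v *)
From HB Require Import structures.
From mathcomp Require Import all_boot all_order all_algebra.
From mathcomp Require Import all_classical all_reals all_analysis.

Set Implicit Arguments.
Unset Strict Implicit.
Unset Printing Implicit Defensive.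

Import Order.TTheory GRing.Theory Num.Theory.

Local Open Scope classical_set_scope.
Local Open Scope ring_scope.
Local Open Scope ereal_scope.

(* Matrices and row vectors indexed by countable sets, with entries in
   [-oo, +oo] so that the products of nonnegative ones always make sense. *)
Definition mat (R : realType) (A B : countType) := A -> B -> \bar R.
Definition row_vec (R : realType) (A : countType) := A -> \bar R.

(* Unordered sum.  It is the usual one when the positive part or the negative
   part of f has a finite sum, and a junk value (-oo) otherwise. *)
Definition usum (R : realType) (A : countType) (f : A -> \bar R) : \bar R :=
  \esum_(i in [set: A]) (f^\+ i) - \esum_(i in [set: A]) (f^\- i).

Definition mulmat (R : realType) (A B C : countType)
    (M : mat R A B) (N : mat R B C) : mat R A C :=
  fun x z => usum (fun y => M x y * N y z).

Definition mulrow (R : realType) (A B : countType)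
    (v : row_vec R A) (M : mat R A B) : row_vec R B :=
  fun y => usum (fun x => v x * M x y).

Notation "M *k N" := (mulmat M N) (at level 40, left associativity).
Notation "v *r M" := (mulrow v M) (at level 40, left associativity).

Definition trmat (R : realType) (A B : countType) (M : mat R A B) : mat R B A :=
  fun y x => M x y.

Definition emat (R : realType) (A B : countType) (M : A -> B -> R) : mat R A B :=
  fun x y => (M x y)%:E.

Definition scalemat (R : realType) (A B : countType) (c : R) (M : mat R A B) :
  mat R A B := fun x y => c%:E * M x y.

Definition idmat (R : realType) (A : countType) : mat R A A :=
  fun x y => (x == y)%:R%:E.
Arguments idmat : clear implicits.

Definition map_kernel (R : realType) (A B : countType) (phi : A -> B) :
  mat R A B := fun x y => (phi x == y)%:R%:E.

(* A measure on a countable discrete set, given by the masses of the points. *)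
Definition is_measure (R : realType) (A : countType) (v : row_vec R A) : Prop :=
  forall x, 0 <= v x.

Definition markov_kernel (R : realType) (A B : countType) (K : mat R A B) :
  Prop :=
  (forall x y, 0 <= K x y) /\
  (forall x, \esum_(y in [set: B]) K x y = 1).

(* Only the values P t with 0 <= t are meaningful. *)
Definition transition_semigroup (R : realType) (S : countType)
    (P : R -> mat R S S) : Prop :=
  [/\ forall t, (0 <= t)%R -> markov_kernel (P t),
      P 0%R = idmat R S &
      forall s t, (0 <= s)%R -> (0 <= t)%R -> P (s + t)%R = P s *k P t].

(* The Markov property is expressed through the finite-dimensional laws:
   Pr(X_{s_0} = x_0, ..., X_{s_(n+1)} = x_(n+1))
     = Pr(X_{s_0} = x_0, ..., X_{s_n} = x_n) P_{s_(n+1) - s_n}(x_n, x_(n+1)). *)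
Definition markov_process (R : realType) (S : countType) (d : measure_display)
    (Omega : measurableType d) (Pr : probability Omega R)
    (X : R -> Omega -> S) (P : R -> mat R S S) : Prop :=
  (forall t x, (0 <= t)%R -> measurable [set w | X t w = x]) /\
  (forall (n : nat) (s : nat -> R) (x : nat -> S),
     (0 <= s 0%N)%R -> (forall i, s i <= s i.+1)%R ->
     Pr [set w | forall i, (i <= n.+1)%N -> X (s i) w = x i] =
     Pr [set w | forall i, (i <= n)%N -> X (s i) w = x i] *
       P (s n.+1 - s n)%R (x n) (x n.+1)).

Definition diagonal (R : realType) (S : countType) (V : S -> S -> R) : Prop :=
  forall x y, x != y -> V x y = 0%R.

Definition inverse_mat (R : realType) (S : countType) (V W : S -> S -> R) :
  Prop := emat V *k emat W = idmat R S /\ emat W *k emat V = idmat R S.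

(* W is the inverse of V. *)
Definition reversible (R : realType) (S : countType) (P : R -> mat R S S) :
  Prop :=
  exists V W : S -> S -> R, [/\ diagonal V, inverse_mat V W &
    forall t, (0 <= t)%R -> emat W *k P t *k emat V = trmat (P t)].

Definition posmat (R : realType) (A B : countType) (M : A -> B -> R) :
  mat R A B := fun x y => (Num.max (M x y) 0)%:E.

Definition negmat (R : realType) (A B : countType) (M : A -> B -> R) :
  mat R A B := fun x y => (Num.max (- M x y) 0)%:E.

(* F is a product in which one factor is left free and all the others are
   nonnegative.  The multiple series obtained by inserting the signed matrix D
   has, at the entry z, positive part F D^+ z and negative part F D^- z; it has
   a value in [-oo, +oo], independent of the order of summation and of the
   bracketing, when these are not both infinite.  This holds in particular when
   D is nonnegative, or when the series converges absolutely. *)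
Definition well_defined (R : realType) (A B C : countType)
    (F : mat R A B -> row_vec R C) (D : A -> B -> R) : Prop :=
  forall z, F (posmat D) z < +oo \/ F (negmat D) z < +oo.

(* Main.v *)
(* With every product well defined, the identities are
     pihat Q_t Dtilde = pi_S P_t Phi Lam D Phi = pi_S P_t D Phi = pi_S D P_t^* Phi
       = pi_S D Phi Lam P_t^* Phi = pihat Dtilde Q_t^*,
   the last one because Lam = c Phi^* gives Q_t^* = Lam P_t^* Phi.  The
   reassociations are done separately for D^+ and D^-, where all factors are
   nonnegative, and the two parts are subtracted at the end.  The equation
   pi_S D Phi Lam = pi_S D says nothing about D^+ and D^- separately, so
   pi_S D P_t^* Phi and pi_S D Phi Lam P_t^* Phi have unrelated parts; those of
   the former are finite when those of the latter are because Phi Lam averages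
   over the fibres of phi, which have 1 / c points, whence c v <= v Phi Lam for
   v >= 0. *)
Require Import Defs.
From mathcomp Require Import all_boot all_order all_algebra.
From mathcomp Require Import all_classical all_reals all_analysis.

Set Implicit Arguments.
Unset Strict Implicit.
Unset Printing Implicit Defensive.

Import Order.TTheory GRing.Theory Num.Theory.

Local Open Scope classical_set_scope.
Local Open Scope ring_scope.
Local Open Scope ereal_scope.

(** * Unordered sums of nonnegative families *)

Lemma ge0_le_esumZl (R : realType) (T : choiceType) (f : T -> \bar R) c :
  (forall x, 0 <= f x) -> 0 <= c ->
  \esum_(x in [set: T]) (c * f x) <= c * \esum_(x in [set: T]) f x.
Proof.
move=> f0 c0; apply: ge_ereal_sup => _ [X [finX _]] <-.
rewrite -ge0_mule_fsumr//; apply: lee_wpmul2l => //.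
by apply: esum_ge; exists X; [split|].
Qed.

(** For finite positive [c] the missing inequality is [ge0_le_esumZl] for the family [c * f] and the
    inverse factor. For [c = +oo] one positive term already makes the left side infinite; otherwise
    all terms vanish. *)
Lemma ge0_esumZl (R : realType) (T : choiceType) (f : T -> \bar R) c :
  (forall x, 0 <= f x) -> 0 <= c ->
  \esum_(x in [set: T]) (c * f x) = c * \esum_(x in [set: T]) f x.
Proof.
move=> f0 c0; apply/eqP; rewrite eq_le ge0_le_esumZl//=.
case: c c0 => [r||//]; last first.
  move=> _; have [|f_gt0] := pselect (exists x, 0 < f x).
    move=> [x fx]; rewrite (@le_trans _ _ +oo) ?leey//.
    apply: esum_ge; exists [set x]; first by split.
    by rewrite fsbig_set1 gt0_mulye.
  rewrite (@esum1 _ _ _ f) ?mule0 ?esum_ge0// => x _.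
    by rewrite mule_ge0.
  apply/eqP; rewrite eq_le f0 andbT leNgt; apply/negP => fx.
  by apply: f_gt0; exists x.
rewrite lee_fin [in X in X -> _]le_eqVlt => /orP[/eqP<-|r0].
  by rewrite mul0e esum_ge0// => x _; rewrite mul0e.
have rf0 x : 0 <= r%:E * f x by rewrite mule_ge0// lee_fin ltW.
rewrite -lee_pdivlMl//; apply: le_trans (ge0_le_esumZl rf0 _); last first.
  by rewrite lee_fin invr_ge0 ltW.
by apply: le_esum => x _; rewrite muleA -EFinM mulVf ?gt_eqF// mul1e.
Qed.

Lemma exchange_esum (R : realType) (T U : choiceType) (f : T -> U -> \bar R) :
  (forall x y, 0 <= f x y) ->
  \esum_(x in [set: T]) \esum_(y in [set: U]) f x y =
  \esum_(y in [set: U]) \esum_(x in [set: T]) f x y.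
Proof.
move=> f0; rewrite !esum_esum//.
rewrite (reindex_esum ([set: U] `*`` (fun=> [set: T])) _ (fun k => (k.2, k.1)))//.
split=> [[u t]//|[u t] [u' t'] _ _ /= [-> ->]//|[t u] _].
by exists (u, t).
Qed.

(** * Signed sums as differences of nonnegative sums *)

Lemma usum_ge0E (R : realType) (A : countType) (f : A -> \bar R) :
  (forall x, 0 <= f x) -> usum f = \esum_(x in [set: A]) f x.
Proof.
move=> f0; rewrite /usum.
rewrite (@esum1 _ _ _ f^\-) => [|i _].
  rewrite sube0; apply: eq_esum => i _.
  by rewrite funeposE; apply/max_idPl.
by rewrite funenegE; apply/max_idPr; rewrite leeNl oppe0.
Qed.

(** Cancellation can make the parts of [u - v] smaller than [u] and [v]. The balance is stated
    additively, so that it can be summed without subtracting infinities. *)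
Lemma posneg_sub (R : realType) (u v : \bar R) :
  0 <= u -> 0 <= v -> u < +oo \/ v < +oo ->
  [/\ maxe (u - v) 0 <= u, maxe (- (u - v)) 0 <= v &
      maxe (u - v) 0 + v = maxe (- (u - v)) 0 + u].
Proof.
case: u v => [a| |] [b| |]// a0 b0 fin; last by case: fin.
- rewrite -EFinB -EFinN -!EFin_max !lee_fin -!EFinD !ge_max.
  move: a0 b0; rewrite !lee_fin => a0 b0.
  split; [by rewrite a0 gerBl b0|by rewrite b0 opprB gerBl a0|congr EFin].
  have [ab|/ltW ba] := leP a b.
    rewrite (max_idPr _) ?subr_le0// (max_idPl _) ?oppr_ge0 ?subr_le0//.
    by rewrite add0r opprB subrK.
  rewrite (max_idPl _) ?subr_ge0// (max_idPr _) ?oppr_le0 ?subr_ge0//.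
  by rewrite add0r subrK.
- by rewrite /= maxNye maxye.
- by rewrite /= maxNye maxye.
Qed.

(** The balance from [posneg_sub] is summed first and subtracted only at the end: the sums of [f^\+]
    and [f^\-] are bounded by those of [u] and [v], one of which is finite. *)
Lemma usumB (R : realType) (A : countType) (f u v : A -> \bar R) :
  (forall x, 0 <= u x) -> (forall x, 0 <= v x) ->
  (forall x, f x = u x - v x) -> usum u < +oo \/ usum v < +oo ->
  usum f = usum u - usum v.
Proof.
move=> u0 v0 fE; rewrite (usum_ge0E u0) (usum_ge0E v0) /usum.
set U := esum _ u; set V := esum _ v => finUV.
have pn x : [/\ f^\+ x <= u x, f^\- x <= v x & f^\+ x + v x = f^\- x + u x].
  rewrite funeposE funenegE fE; apply: posneg_sub => //.
  have le_U : u x <= U by apply: esum_ge; exists [set x]; rewrite ?fsbig_set1.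
  have le_V : v x <= V by apply: esum_ge; exists [set x]; rewrite ?fsbig_set1.
  by case: finUV => [/(le_lt_trans le_U)|/(le_lt_trans le_V)]; [left|right].
have : \esum_(x in [set: A]) f^\+ x + V = \esum_(x in [set: A]) f^\- x + U.
  by rewrite -!esumD//; apply: eq_esum => x _; case: (pn x).
have : \esum_(x in [set: A]) f^\- x <= V by apply: le_esum => x _; case: (pn x).
have : \esum_(x in [set: A]) f^\+ x <= U by apply: le_esum => x _; case: (pn x).
have : 0 <= \esum_(x in [set: A]) f^\+ x by exact: esum_ge0.
have : 0 <= \esum_(x in [set: A]) f^\- x by exact: esum_ge0.
have : 0 <= U by exact: esum_ge0.
have : 0 <= V by exact: esum_ge0.
move: (\esum_(x in [set: A]) f^\+ x) (\esum_(x in [set: A]) f^\- x).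
move: U V finUV => {pn}.
move=> [a| |] [b| |] fin [p| |] [q| |]//= _ _ _ _ _ _; try by case: fin.
move=> [pb]; congr EFin; apply/eqP.
by rewrite subr_eq addrAC eq_sym subr_eq pb addrC.
Qed.

(** * Products of nonnegative factors *)

Lemma mulmat_ge0 (R : realType) (A B C : countType)
    (M : mat R A B) (N : mat R B C) :
  (forall x y, 0 <= M x y) -> (forall y z, 0 <= N y z) ->
  forall x z, 0 <= (M *k N) x z.
Proof.
move=> M0 N0 x z; have MN0 y : 0 <= M x y * N y z by exact: mule_ge0.
by rewrite /mulmat usum_ge0E// esum_ge0.
Qed.

(** By Tonelli: the two bracketings sum the same nonnegative terms in opposite orders. *)
Lemma ge0_mulmatA (R : realType) (A B C E : countType)
    (M : mat R A B) (N : mat R B C) (K : mat R C E) :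
  (forall x y, 0 <= M x y) -> (forall y z, 0 <= N y z) ->
  (forall z w, 0 <= K z w) -> M *k N *k K = M *k (N *k K).
Proof.
move=> M0 N0 K0; apply/funext => x; apply/funext => w.
have MN0 y z : 0 <= M x y * N y z by exact: mule_ge0.
have NK0 y z : 0 <= N y z * K z w by exact: mule_ge0.
rewrite {1 3}/mulmat !usum_ge0E; [|by move=> *; rewrite mule_ge0// mulmat_ge0..].
rewrite (eq_esum (b := fun z => \esum_(y in [set: B]) M x y * N y z * K z w)).
  rewrite exchange_esum; last by move=> *; rewrite mule_ge0.
  apply: eq_esum => y _; rewrite /mulmat usum_ge0E// -ge0_esumZl//.
  by apply: eq_esum => z _; rewrite muleA.
move=> z _; rewrite /mulmat usum_ge0E// muleC -ge0_esumZl//.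
by apply: eq_esum => y _; rewrite muleC.
Qed.

Lemma ge0_mulrowA (R : realType) (A B C : countType)
    (v : row_vec R A) (M : mat R A B) (N : mat R B C) :
  (forall x, 0 <= v x) -> (forall x y, 0 <= M x y) ->
  (forall y z, 0 <= N y z) -> v *r M *r N = v *r (M *k N).
Proof.
(* A row vector is treated as a matrix with row index set [unit]. *)
move=> v0 M0 N0; have := @ge0_mulmatA R unit A B C (fun=> v) M N.
by move=> /(_ (fun=> v0) M0 N0)/(congr1 (@^~ tt)).
Qed.

Lemma mulrow_ge0 (R : realType) (A B : countType)
    (v : row_vec R A) (M : mat R A B) :
  (forall x, 0 <= v x) -> (forall x y, 0 <= M x y) -> forall y, 0 <= (v *r M) y.
Proof. by move=> v0 M0; apply: (@mulmat_ge0 R unit A B (fun=> v) M _ _ tt). Qed.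

Lemma trmat_mul (R : realType) (A B C : countType)
    (M : mat R A B) (N : mat R B C) : trmat (M *k N) = trmat N *k trmat M.
Proof.
apply/funext => z; apply/funext => x; rewrite /trmat /mulmat; congr usum.
by apply/funext => y; rewrite muleC.
Qed.

Lemma mulmat_scalel (R : realType) (A B C : countType) (c : R)
    (M : mat R A B) (N : mat R B C) :
  scalemat c M *k N = M *k scalemat c N.
Proof.
apply/funext => x; apply/funext => z; rewrite /mulmat /scalemat; congr usum.
by apply/funext => y; rewrite muleCA muleA.
Qed.

(** * Signed products carried along with two nonnegative parts *)

(* When both parts are infinite the value of the signed quantity is left
   unspecified, which is what makes the relation stable under products. *)
Definition signed_parts (R : realType) (a p n : \bar R) : Prop :=
  p < +oo \/ n < +oo -> a = p - n.

(** The delicate case is [w = +oo]: finiteness of [w * p] or [w * n] then forces [p] or [n] to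
    vanish. *)
Lemma signed_partsZl (R : realType) (w a p n : \bar R) :
  0 <= w -> 0 <= p -> 0 <= n -> signed_parts a p n ->
  signed_parts (w * a) (w * p) (w * n).
Proof.
move=> + + + sa; rewrite le_eqVlt => /orP[/eqP<- _ _ _|w0 p0 n0 fin].
  by rewrite !mul0e sube0.
have pn_fin : p < +oo \/ n < +oo.
  case: fin => wfin; [left|right]; rewrite ltNge leye_eq; apply/negP => /eqP E;
    by rewrite E gt0_muley ?ltxx in wfin.
rewrite (sa pn_fin); case: w w0 fin => [r||]// _ fin.
  rewrite muleBr//; case: p n p0 n0 {sa fin} pn_fin => [p||] [n||]//.
  by move=> _ _ [].
move: p0 n0; rewrite le_eqVlt => /orP[/eqP<- _|p0].
  by rewrite mule0 !sub0e muleN.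
rewrite le_eqVlt => /orP[/eqP<-|n0]; first by rewrite mule0 !sube0.
by case: fin; rewrite gt0_mulye ?ltxx.
Qed.

Lemma signed_parts_usum (R : realType) (A : countType) (f p n : A -> \bar R) :
  (forall x, 0 <= p x) -> (forall x, 0 <= n x) ->
  (forall x, signed_parts (f x) (p x) (n x)) ->
  signed_parts (usum f) (usum p) (usum n).
Proof.
move=> p0 n0 fpn fin; apply: usumB => // x; apply: fpn.
have le_p : p x <= usum p.
  by rewrite usum_ge0E//; apply: esum_ge; exists [set x]; rewrite ?fsbig_set1.
have le_n : n x <= usum n.
  by rewrite usum_ge0E//; apply: esum_ge; exists [set x]; rewrite ?fsbig_set1.
by case: fin => [/(le_lt_trans le_p)|/(le_lt_trans le_n)]; [left|right].
Qed.

(** [Mp] and [Mn] need not be the positive and negative parts of [M]: products of parts ignore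
    cancellation. *)
Definition mat_parts (R : realType) (A B : countType) (M Mp Mn : mat R A B) :=
  forall x y, [/\ 0 <= Mp x y, 0 <= Mn x y &
    signed_parts (M x y) (Mp x y) (Mn x y)].

Lemma mat_parts_mull (R : realType) (A B C : countType)
    (K : mat R A B) (M Mp Mn : mat R B C) :
  (forall x y, 0 <= K x y) -> mat_parts M Mp Mn ->
  mat_parts (K *k M) (K *k Mp) (K *k Mn).
Proof.
move=> K0 Mpn x z.
have p0 y w : 0 <= Mp y w by case: (Mpn y w).
have n0 y w : 0 <= Mn y w by case: (Mpn y w).
split; [exact: mulmat_ge0..|].
apply: signed_parts_usum => y; rewrite ?mule_ge0//.
by apply: signed_partsZl => //; case: (Mpn y z).
Qed.

Lemma mat_parts_mulr (R : realType) (A B C : countType)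
    (M Mp Mn : mat R A B) (K : mat R B C) :
  (forall x y, 0 <= K x y) -> mat_parts M Mp Mn ->
  mat_parts (M *k K) (Mp *k K) (Mn *k K).
Proof.
move=> K0 Mpn x z.
have p0 y w : 0 <= Mp y w by case: (Mpn y w).
have n0 y w : 0 <= Mn y w by case: (Mpn y w).
split; [exact: mulmat_ge0..|].
apply: signed_parts_usum => y; rewrite ?mule_ge0// ![_ * K _ _]muleC.
by apply: signed_partsZl => //; case: (Mpn x y).
Qed.

Lemma mat_parts_emat (R : realType) (A B : countType) (D : A -> B -> R) :
  mat_parts (emat D) (posmat D) (negmat D).
Proof.
move=> x y; rewrite /emat /posmat /negmat !lee_fin !le_max !lexx !orbT; split=> //.
move=> _; have := funeposneg (fun _ : unit => (D x y)%:E).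
by move=> /(congr1 (@^~ tt)); rewrite funeposE funenegE -EFinN -!EFin_max.
Qed.

Lemma row_parts_mull (R : realType) (A B : countType)
    (v : row_vec R A) (M Mp Mn : mat R A B) :
  (forall x, 0 <= v x) -> mat_parts M Mp Mn ->
  mat_parts (fun _ : unit => v *r M) (fun=> v *r Mp) (fun=> v *r Mn).
Proof.
by move=> v0; apply: (@mat_parts_mull R unit A B (fun=> v)).
Qed.

Lemma row_parts_mulr (R : realType) (A B : countType)
    (v vp vn : row_vec R A) (K : mat R A B) :
  (forall x y, 0 <= K x y) ->
  mat_parts (fun _ : unit => v) (fun=> vp) (fun=> vn) ->
  mat_parts (fun _ : unit => v *r K) (fun=> vp *r K) (fun=> vn *r K).
Proof. exact: mat_parts_mulr. Qed.

(** Transfers associativity from nonnegative to signed products. *)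
Lemma row_parts_inj (R : realType) (A : countType)
    (v vp vn w wp wn : row_vec R A) x :
  mat_parts (fun _ : unit => v) (fun=> vp) (fun=> vn) ->
  mat_parts (fun _ : unit => w) (fun=> wp) (fun=> wn) ->
  vp = wp -> vn = wn -> vp x < +oo \/ vn x < +oo -> v x = w x.
Proof.
move=> /(_ tt x)[_ _ vE] /(_ tt x)[_ _ wE] eqp eqn fin.
by rewrite vE// wE -?eqp -?eqn.
Qed.

(** * Scalars and lower bounds in nonnegative products *)

Lemma ge0_scalematE (R : realType) (A B C : countType) (c : R)
    (M : mat R A B) (N : mat R B C) : (0 <= c)%R ->
  (forall x y, 0 <= M x y) -> (forall y z, 0 <= N y z) ->
  scalemat c (M *k N) = M *k scalemat c N.
Proof.
move=> c0 M0 N0; apply/funext => x; apply/funext => z.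
have MN0 y : 0 <= M x y * N y z by exact: mule_ge0.
rewrite /mulmat /scalemat !usum_ge0E// => [|y]; last first.
  by rewrite !mule_ge0.
by rewrite -ge0_esumZl//; apply: eq_esum => y _; rewrite muleCA.
Qed.

Lemma mulrow_ge_term (R : realType) (A B : countType)
    (v : row_vec R A) (M : mat R A B) x y :
  (forall x, 0 <= v x) -> (forall x y, 0 <= M x y) ->
  v x * M x y <= (v *r M) y.
Proof.
move=> v0 M0; rewrite /mulrow usum_ge0E; last by move=> i; exact: mule_ge0.
by apply: esum_ge; exists [set x]; rewrite ?fsbig_set1.
Qed.

Lemma ge0_mulrow_le (R : realType) (A B : countType) (c : R)
    (v w : row_vec R A) (M : mat R A B) y : (0 <= c)%R ->
  (forall x, 0 <= v x) -> (forall x, c%:E * v x <= w x) ->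
  (forall x y, 0 <= M x y) -> c%:E * (v *r M) y <= (w *r M) y.
Proof.
move=> c0 v0 vw M0.
have w0 x : 0 <= w x by apply: le_trans (vw x); rewrite mule_ge0.
rewrite /mulrow !usum_ge0E; [|by move=> x; exact: mule_ge0..].
rewrite -ge0_esumZl//; last by move=> x; exact: mule_ge0.
by apply: le_esum => x _; rewrite muleA lee_wpmul2r.
Qed.

Theorem proposition3p3 (R : realType) (S Shat : countType)
  (d : measure_display) (Omega : measurableType d) (Pr : probability Omega R)
  (X : R -> Omega -> S) (P : R -> mat R S S)
  (phi : S -> Shat) (Lam : mat R Shat S) (pihat : row_vec R Shat)
  (D : S -> S -> R) :
  let Phi := map_kernel R phi in
  let piS := pihat *r Lam in
  let Q := fun t : R => Lam *k P t *k Phi in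
  let compress := fun M : mat R S S => Lam *k M *k Phi in
  let Dtilde := compress (emat D) in
  transition_semigroup P ->
  markov_process Pr X P ->
  markov_kernel Lam ->
  Lam *k Phi = idmat R Shat ->
  is_measure pihat ->
  (forall t : R, (0 <= t)%R ->
     pihat *r Lam *r P t = pihat *r Lam *r P t *r Phi *r Lam) ->
  reversible P ->
  (exists c : R, Lam = scalemat c (trmat Phi)) ->
  (forall t : R, (0 <= t)%R -> P t *k emat D = emat D *k trmat (P t)) ->
  piS *r emat D *r Phi *r Lam = piS *r emat D ->
  (* both sides of the conclusion are well-defined multiple series *)
  (forall t : R, (0 <= t)%R ->
     well_defined (fun M => pihat *r Q t *r compress M) D) ->
  (forall t : R, (0 <= t)%R ->
     well_defined (fun M => pihat *r compress M *r trmat (Q t)) D) ->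
  forall t : R, (0 <= t)%R ->
    pihat *r Q t *r Dtilde = pihat *r Dtilde *r trmat (Q t).
Proof.
move=> Phi piS Q compress Dtilde [P_markov _ _] _ [Lam0 Lam1] _ pihat0.
move=> intertw _ [c LamE] PD piDPhiLam wdQD wdDQ t t0.
have Pt0 x y : 0 <= P t x y by case: (P_markov t t0).
have Phi0 x y : 0 <= Phi x y by rewrite lee_fin ler0n.
have piS0 x : 0 <= piS x by exact: mulrow_ge0.
have Dpm := mat_parts_emat D.
have Dp0 x y : 0 <= posmat D x y by case: (Dpm x y).
have Dn0 x y : 0 <= negmat D x y by case: (Dpm x y).
have PT0 x y : 0 <= trmat (P t) x y by exact: Pt0.
have Q0 x y : 0 <= Q t x y by do 2!apply: mulmat_ge0 => //.
have QT0 x y : 0 <= trmat (Q t) x y by exact: Q0.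
have piQ0 x : 0 <= (pihat *r Q t) x by exact: mulrow_ge0.
apply/funext => z.
(* Otherwise the nonnegative row [z] of [Lam] would be zero, while its sum is 1. *)
have c0 : (0 < c)%R.
  rewrite ltNge; apply/negP => c_le0; have := Lam1 z.
  rewrite esum1 => [/eqP|y _]; first by rewrite eqe eq_sym oner_eq0.
  apply/eqP; rewrite eq_le Lam0 andbT LamE.
  by rewrite /scalemat -EFinM lee_fin mulr_le0_ge0.
have PTPhi0 : forall x y, 0 <= (trmat (P t) *k Phi) x y by exact: mulmat_ge0.
have LamM0 (M : mat R S S) : (forall x y, 0 <= M x y) ->
  forall x y, 0 <= (Lam *k M) x y by exact: mulmat_ge0.
(* The scalar [c] leaves [Lam] on the left, making it [trmat Phi], and turns [Phi] on the right into
   [trmat Lam]. *)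
have trQ : trmat (Q t) = Lam *k (trmat (P t) *k Phi).
  rewrite /Q !trmat_mul [in RHS]LamE mulmat_scalel; congr (_ *k _).
  rewrite ge0_scalematE//; last exact: ltW.
  by rewrite LamE.
have compressE (M : mat R S S) (v : row_vec R Shat) :
    (forall x y, 0 <= M x y) -> (forall x, 0 <= v x) ->
    v *r compress M = v *r Lam *r M *r Phi.
  move=> M0 v0; rewrite -ge0_mulrowA -?ge0_mulrowA//; exact: LamM0.
(* The intertwining relation absorbs the [Phi *k Lam] between [P t] and [M]. *)
have QL (M : mat R S S) : (forall x y, 0 <= M x y) ->
    pihat *r Q t *r compress M = piS *r (P t *k M) *r Phi.
  move=> M0; rewrite compressE// (compressE (P t))// -(intertw t t0).
  by rewrite -(ge0_mulrowA piS0 Pt0 M0).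
have QR (M : mat R S S) : (forall x y, 0 <= M x y) ->
    pihat *r compress M *r trmat (Q t) =
    piS *r M *r Phi *r Lam *r (trmat (P t) *k Phi).
  move=> M0; rewrite compressE// trQ -ge0_mulrowA//.
  by do 2!apply: mulrow_ge0 => //; exact: mulrow_ge0.
have piDpm := row_parts_mull piS0 Dpm.
have Dtpm := mat_parts_mulr Phi0 (mat_parts_mull Lam0 Dpm).
have lhs_pm := row_parts_mull piQ0 Dtpm.
have PD_pm := row_parts_mulr Phi0
  (row_parts_mull piS0 (mat_parts_mull Pt0 Dpm)).
have rhs_pm := row_parts_mulr QT0 (row_parts_mull pihat0 Dtpm).
have DPhiLamP_pm := row_parts_mulr PTPhi0
  (row_parts_mulr Lam0 (row_parts_mulr Phi0 piDpm)).
have DP_pm := row_parts_mulr Phi0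
  (row_parts_mull piS0 (mat_parts_mulr PT0 Dpm)).
(* This bracketing keeps [piS *r emat D] as a block, ready for substituting [piDPhiLam]. *)
have DP_pm' := row_parts_mulr PTPhi0 piDpm.
have assoc (M : mat R S S) : (forall x y, 0 <= M x y) ->
    piS *r (M *k trmat (P t)) *r Phi = piS *r M *r (trmat (P t) *k Phi).
  by move=> M0; rewrite -!ge0_mulrowA//; exact: mulrow_ge0.
(* Only the path from [w] through [phi w] back to [w] is kept; its weight is [c]. *)
have fibre (v : row_vec R S) : (forall x, 0 <= v x) ->
    forall w, c%:E * v w <= (v *r Phi *r Lam) w.
  move=> v0 w; have vPhi0 := mulrow_ge0 v0 Phi0.
  apply: le_trans (mulrow_ge_term (phi w) w vPhi0 Lam0).
  rewrite {1}LamE /scalemat /trmat /Phi {2}/map_kernel eqxx mule1 muleC.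
  apply: lee_wpmul2r; first by rewrite lee_fin ltW.
  have := mulrow_ge_term w (phi w) v0 Phi0.
  by rewrite {1}/Phi {1}/map_kernel eqxx mule1.
have fin_part (M : mat R S S) : (forall x y, 0 <= M x y) ->
    (pihat *r compress M *r trmat (Q t)) z < +oo ->
    (piS *r M *r (trmat (P t) *k Phi)) z < +oo.
  move=> M0; rewrite QR//; have v0 := mulrow_ge0 piS0 M0.
  move=> /(le_lt_trans (ge0_mulrow_le z (ltW c0) v0 (fibre _ v0) PTPhi0)).
  rewrite !ltNge; apply: contra; rewrite !leye_eq => /eqP ->.
  by rewrite gt0_muley// lte_fin.
apply: etrans
  (row_parts_inj lhs_pm PD_pm (QL _ Dp0) (QL _ Dn0) (wdQD t t0 z)) _.
rewrite (PD t t0).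
(* The well-definedness of this intermediate product comes from that of the right-hand side, through
   the fibre bound. *)
have fin : (piS *r posmat D *r (trmat (P t) *k Phi)) z < +oo \/
           (piS *r negmat D *r (trmat (P t) *k Phi)) z < +oo.
  by case: (wdDQ t t0 z) => [/(fin_part _ Dp0)|/(fin_part _ Dn0)]; [left|right].
apply: etrans (esym (row_parts_inj DP_pm' DP_pm
  (esym (assoc _ Dp0)) (esym (assoc _ Dn0)) fin)) _.
(* The hypothesis is applied to the signed row itself, since it does not pass to the parts. *)
rewrite -piDPhiLam.
exact: (esym (row_parts_inj rhs_pm DPhiLamP_pm
  (QR _ Dp0) (QR _ Dn0) (wdDQ t t0 z))).
Qed.
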